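(* Let $T=\{1324,1432,3142\}$. Then $$F_T(x)=\frac{1-x}{2-2x-(1-x-x^2)C(x)}.$$
   Context: $S_n(T)$ denotes the set of permutations $\pi$ of $[n]=\{1,\dots,n\}$ (one-line notation) that avoid every pattern $\tau\in T$, i.e. no subsequence of $\pi$ is order-isomorphic to $\tau$. $F_T(x)=\sum_{n\ge 0}|S_n(T)|x^n$, a formal power series, with $|S_0(T)|=1$. $C(x)=\frac{1-\sqrt{1-4x}}{2x}=\sum_{n\ge0}\frac{1}{n+1}\binom{2n}{n}x^n$ is the generating function of the Catalan numbers. *)

(* Defs.v *)
From HB Require Import structures.
From mathcomp Require Import all_boot all_order all_algebra all_fingroup.
From mathcomp Require Import boolp.

Set Implicit Arguments.
Unset Strict Implicit.
Unset Printing Implicit Defensive.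

Import GRing.Theory.
Local Open Scope ring_scope.

(* Formal power series over a field, with [Fps a] standing for              *)
(* \sum_n (a n) x^n.  They form a commutative ring with units under the     *)
(* Cauchy product, so that [f / g] is the usual quotient of series whenever *)
(* [g 0] is nonzero (lemma [unit_fpsE]).                                    *)
Record fps (K : fieldType) := Fps { fps_coef :> nat -> K }.

Notation "{ 'fps' K }" := (fps K) (at level 0, format "{ 'fps'  K }").

HB.instance Definition _ (K : fieldType) := gen_eqMixin {fps K}.
HB.instance Definition _ (K : fieldType) := gen_choiceMixin {fps K}.

Section FormalPowerSeries.
Variable K : fieldType.
Implicit Types f g h : {fps K}.

Lemma fpsP f g : f =1 g -> f = g.
Proof. by case: f g => [a] [b] /= /funext ->. Qed.

Definition fps_zero : {fps K} := Fps (fun=> 0).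
Definition fps_opp f : {fps K} := Fps (fun n => - f n).
Definition fps_add f g : {fps K} := Fps (fun n => f n + g n).

Fact fps_addA : associative fps_add.
Proof. by move=> f g h; apply: fpsP => n /=; rewrite addrA. Qed.
Fact fps_addC : commutative fps_add.
Proof. by move=> f g; apply: fpsP => n /=; rewrite addrC. Qed.
Fact fps_add0 : left_id fps_zero fps_add.
Proof. by move=> f; apply: fpsP => n /=; rewrite add0r. Qed.
Fact fps_addN : left_inverse fps_zero fps_opp fps_add.
Proof. by move=> f; apply: fpsP => n /=; rewrite addNr. Qed.

HB.instance Definition _ :=
  GRing.isZmodule.Build {fps K} fps_addA fps_addC fps_add0 fps_addN.

Definition fps_one : {fps K} := Fps (fun n => (n == 0%N)%:R).
Definition fps_mul f g : {fps K} :=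
  Fps (fun n => \sum_(i < n.+1) f i * g (n - i)%N).

Definition fps_trunc m f : {poly K} := \poly_(i < m.+1) f i.

Fact coef_fps_trunc m f n : (n <= m)%N -> (fps_trunc m f)`_n = f n.
Proof. by move=> le_nm; rewrite coef_poly ltnS le_nm. Qed.

Fact fps_mul_trunc m f g n :
  (n <= m)%N -> fps_mul f g n = (fps_trunc m f * fps_trunc m g)`_n.
Proof.
move=> le_nm; rewrite coefM; apply: eq_bigr => i _.
rewrite !coef_fps_trunc //; first exact: leq_trans (leq_subr _ _) le_nm.
by apply: leq_trans le_nm; rewrite -ltnS.
Qed.

Fact fps_mulA : associative fps_mul.
Proof.
move=> f g h; apply: fpsP => n.
transitivity (fps_trunc n f * (fps_trunc n g * fps_trunc n h))`_n.
  rewrite coefM; apply: eq_bigr => i _.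
  by rewrite coef_fps_trunc ?leq_ord // (fps_mul_trunc _ _ (leq_subr i n)).
rewrite mulrA coefM; apply: eq_bigr => i _.
by rewrite (@fps_mul_trunc n) ?leq_ord // coef_fps_trunc ?leq_subr.
Qed.
Fact fps_mulC : commutative fps_mul.
Proof.
by move=> f g; apply: fpsP => n; rewrite !(@fps_mul_trunc n) // mulrC.
Qed.
Fact fps_mul1 : left_id fps_one fps_mul.
Proof.
move=> f; apply: fpsP => n /=.
by rewrite big_ord_recl /= mul1r subn0 big1 ?addr0 // => i _; rewrite mul0r.
Qed.
Fact fps_mulDl : left_distributive fps_mul fps_add.
Proof.
move=> f g h; apply: fpsP => n /=; rewrite -big_split /=.
by apply: eq_bigr => i _; rewrite mulrDl.
Qed.
Fact fps_oner_neq0 : fps_one != 0.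
Proof.
apply/eqP => /(congr1 (fun f : {fps K} => f 0%N)) /= /eqP.
by rewrite oner_eq0.
Qed.

HB.instance Definition _ := GRing.Zmodule_isComNzRing.Build {fps K}
  fps_mulA fps_mulC fps_mul1 fps_mulDl fps_oner_neq0.

(* The coefficients of degree 0, ..., n of the inverse of [f]. *)
Fixpoint fps_inv_coefs f n : seq K :=
  if n is m.+1 then
    let s := fps_inv_coefs f m in
    rcons s (- (f 0%N)^-1 * \sum_(i < n) f (n - i)%N * s`_i)
  else [:: (f 0%N)^-1].

Definition fps_unit : {pred {fps K}} := fun f => f 0%N != 0.
Definition fps_inv f : {fps K} :=
  if f 0%N != 0 then Fps (fun n => (fps_inv_coefs f n)`_n) else f.

Fact size_fps_inv_coefs f n : size (fps_inv_coefs f n) = n.+1.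
Proof. by elim: n => //= n IHn; rewrite size_rcons IHn. Qed.

Fact nth_fps_inv_coefs f n i :
  (i <= n)%N -> (fps_inv_coefs f n)`_i = (fps_inv_coefs f i)`_i.
Proof.
elim: n => [|n IHn]; first by rewrite leqn0 => /eqP ->.
rewrite leq_eqVlt => /predU1P[-> // | lt_in].
by rewrite /= nth_rcons size_fps_inv_coefs lt_in IHn.
Qed.

Fact fps_mulV : {in fps_unit, left_inverse 1 fps_inv *%R}.
Proof.
move=> f f0; rewrite -topredE /= /fps_unit in f0; apply: fpsP => -[|n].
  by rewrite /= big_ord_recl big_ord0 /= /fps_inv f0 /= mulVf // addr0.
rewrite /= /fps_inv f0 big_ord_recr /= subnn.
rewrite nth_rcons size_fps_inv_coefs ltnn eqxx.
rewrite mulrAC mulNr mulVf // mulN1r.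
apply/eqP; rewrite subr_eq0; apply/eqP; apply: eq_bigr => i _.
by rewrite mulrC [in RHS]nth_fps_inv_coefs // -ltnS.
Qed.
Fact fps_unitPl f g : g * f = 1 -> f \in fps_unit.
Proof.
move=> /(congr1 (fun h : {fps K} => h 0%N)) /=.
rewrite big_ord_recl big_ord0 /= addr0 => gf1.
rewrite -topredE /= /fps_unit; apply/eqP => f0.
by move/eqP: gf1; rewrite f0 mulr0 eq_sym oner_eq0.
Qed.
Fact fps_inv_out : {in [predC fps_unit], fps_inv =1 id}.
Proof.
by move=> f; rewrite -topredE /= -topredE /= /fps_unit /fps_inv => /negbTE ->.
Qed.

HB.instance Definition _ := GRing.ComNzRing_hasMulInverse.Build {fps K}
  fps_mulV fps_unitPl fps_inv_out.

Lemma unit_fpsE f : (f \is a GRing.unit) = (f 0%N != 0).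
Proof. by []. Qed.

Definition fpsX : {fps K} := Fps (fun n => (n == 1%N)%:R).

End FormalPowerSeries.

Notation "\fps_ n E" := (Fps (fun n : nat => E))
  (at level 36, E at level 36, n at level 2, format "\fps_ n  E") : ring_scope.

(* Words are sequences of naturals; [s] and [t] are order-isomorphic when   *)
(* they have the same length and their entries compare in the same way.     *)
Definition order_iso (s t : seq nat) : bool :=
  (size s == size t) &&
  [forall i : 'I_(size t), forall j : 'I_(size t),
     (nth 0%N s i < nth 0%N s j)%N == (nth 0%N t i < nth 0%N t j)%N].

(* Permutations of [n] are encoded in 'S_n, which acts on {0, ..., n - 1}.  *)
Definition oneline n (p : 'S_n) : seq nat := [seq (p i).+1 | i <- enum 'I_n].

(* The masks of length n select exactly the subsequences of [oneline p].    *)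
Definition contains n (p : 'S_n) (tau : seq nat) : bool :=
  [exists m : n.-tuple bool, order_iso (mask m (oneline p)) tau].

Lemma containsP n (p : 'S_n) (tau : seq nat) :
  reflect (exists2 s, subseq s (oneline p) & order_iso s tau) (contains p tau).
Proof.
have size_p : size (oneline p) = n by rewrite size_map size_enum_ord.
apply: (iffP existsP) => [[m iso_m] | [s /subseqP[m sz_m ->] iso_s]].
  by exists (mask m (oneline p)); first exact: mask_subseq.
have sz_mn : size m == n by rewrite sz_m size_p.
by exists (Tuple sz_mn).
Qed.

Definition avoiders n (T : seq (seq nat)) : {set 'S_n} :=
  [set p : 'S_n | all (fun tau => ~~ contains p tau) T].

Definition avoid_gf (T : seq (seq nat)) : {fps rat} :=
  \fps_n #|avoiders n T|%:R.

Definition catalan_gf : {fps rat} := \fps_n ('C(2 * n, n)%:R / n.+1%:R).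

(* Main.v *)
(* Build permutations by inserting a new minimum.  For an avoider, the positions
   where the insertion keeps avoidance (its active sites) evolve in a way that
   depends only on the set of active sites and on the lengths of two initial
   decreasing runs of the word recording the inverse permutation.  The resulting generating tree has
   nodes of three kinds: those without an initial run, whose subtree depends only
   on the number s + 1 of active sites and has generating function F C^s, and
   those with an initial run of length a, followed or not by a second run, whose
   generating functions are B + F (1 + x C^3) C^a and B + F C^a.  Here F is the
   generating function of the root, and the two linear equations relating F and B
   give the formula. *)

Require Import Defs.
From mathcomp Require Import all_boot all_order all_algebra all_fingroup.
From mathcomp Require Import ring zify.

Set Implicit Arguments.
Unset Strict Implicit.
Unset Printing Implicit Defensive.
Import Order.TTheory GRing.Theory Num.Theory.

(** * Words and active sites *)

Section TriplesQuadruples.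
Variable T : Type.

Fixpoint all3 (P : T -> T -> T -> bool) (s : seq T) : bool :=
  if s is x :: s' then pairwise (P x) s' && all3 P s' else true.

Fixpoint all4 (P : T -> T -> T -> T -> bool) (s : seq T) : bool :=
  if s is x :: s' then all3 (P x) s' && all4 P s' else true.

Lemma eq_all3 (P Q : T -> T -> T -> bool) s :
  (forall x y z, P x y z = Q x y z) -> all3 P s = all3 Q s.
Proof.
by move=> eqPQ; elim: s => //= x s ->; congr (_ && _); apply: eq_pairwise.
Qed.

Lemma eq_all4 (P Q : T -> T -> T -> T -> bool) s :
  (forall x y z t, P x y z t = Q x y z t) -> all4 P s = all4 Q s.
Proof. by move=> eqPQ; elim: s => //= x s ->; rewrite (eq_all3 _ (eqPQ x)). Qed.

End TriplesQuadruples.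

Lemma all3_map (T U : Type) (f : U -> T) P s :
  all3 P (map f s) = all3 (fun x y z => P (f x) (f y) (f z)) s.
Proof. by elim: s => //= x s ->; rewrite pairwise_map. Qed.

Lemma all4_map (T U : Type) (f : U -> T) P s :
  all4 P (map f s) = all4 (fun x y z t => P (f x) (f y) (f z) (f t)) s.
Proof. by elim: s => //= x s ->; rewrite all3_map. Qed.

Section Subseqs.
Variable T : eqType.

Lemma pairwise_subseqP (r : rel T) s :
  reflect (forall x y, subseq [:: x; y] s -> r x y) (pairwise r s).
Proof.
elim: s => [|a s IHs] /=; first by constructor.
apply: (iffP andP) => [[/allP ra /IHs rs] x y | rs].
  by case: eqP => [-> | _]; rewrite ?sub1seq; [apply: ra | apply: rs].
split; last first.
  by apply/IHs => x y xy; apply: rs; case: eqP => _ //; apply: cons_subseq xy.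
by apply/allP => y sy; apply: rs; rewrite eqxx sub1seq.
Qed.

Lemma all3P (P : T -> T -> T -> bool) (s : seq T) :
  reflect (forall x y z, subseq [:: x; y; z] s -> P x y z) (all3 P s).
Proof.
elim: s => [|a s IHs] /=; first by constructor.
apply: (iffP andP) => [[/pairwise_subseqP ra /IHs rs] x y z | rs].
  by case: eqP => [-> | _]; [apply: ra | apply: rs].
split; last first.
  by apply/IHs => x y z xyz; apply: rs; case: eqP => _ //; apply: cons_subseq xyz.
by apply/pairwise_subseqP => y z yz; apply: rs; rewrite eqxx.
Qed.

Lemma all4P (P : T -> T -> T -> T -> bool) (s : seq T) :
  reflect (forall x y z t, subseq [:: x; y; z; t] s -> P x y z t) (all4 P s).
Proof.
elim: s => [|a s IHs] /=; first by constructor.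
apply: (iffP andP) => [[/all3P ra /IHs rs] x y z t | rs].
  by case: eqP => [-> | _]; [apply: ra | apply: rs].
split; last first.
  by apply/IHs => x y z t w; apply: rs; case: eqP => _ //; apply: cons_subseq w.
by apply/all3P => y z t w; apply: rs; rewrite eqxx.
Qed.

End Subseqs.

Definition ins k (w : seq nat) := k :: map (bump k) w.

(* The reversed complement of the inverse turns 1324, 1432 and 3142 into the
   patterns 4231, 4123 and 3142 forbidden here. *)
Definition avoids4 a b c d :=
  ~~ [|| (d < b < c) && (c < a), (b < c < d) && (d < a) | (b < d < a) && (a < c)].

(* [avoids4] for a new first letter [k], the old letters [>= k] being bumped. *)
Definition avoids3 k x y z :=
  ~~ [|| (z < x < y) && (y < k), (x < y < z) && (z < k) | (x < z < k) && (k <= y)].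

(* [avoids3 (k + i).+1] with [k] as the first of the three letters.  For [0 < i],
   [split_site w k i] forces [w] to begin with [k-1 ... 0] then [k+i-1 ... k]. *)
Definition avoids2 k i y z :=
  ~~ [|| (z < k <= y) && (y < k + i), (k <= y < z) && (z < k + i)
       | (k <= z < k + i) && (k + i <= y)].

Definition avoiding : pred (seq nat) := all4 avoids4.
Definition active w k := all3 (avoids3 k) w.
Definition split_site w k i := active w (k + i) && pairwise (avoids2 k i) w.

(** Bumping preserves order, so the only new quadruples to test begin with the new letter. *)
Lemma avoiding_ins k w : avoiding (ins k w) = active w k && avoiding w.
Proof.
rewrite /avoiding /ins /= all3_map all4_map; congr (_ && _).
  by apply: eq_all3 => x y z; rewrite /avoids4 /avoids3 /bump; lia.
by apply: eq_all4 => x y z t; rewrite /avoids4 /bump; lia.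
Qed.

(** The front letter [k] could only be second in an occurrence led by [j], and in each pattern the
    second letter is smaller than the first. *)
Lemma active_ins_le k j w : j <= k -> active (ins k w) j = active w j.
Proof.
move=> le_jk; rewrite /active /ins /= all3_map pairwise_map.
rewrite [pairwise _ _](_ : _ = true) /=.
  by apply: eq_all3 => x y z; rewrite /avoids3 /bump; lia.
by apply/pairwise_subseqP => y z _; rewrite /= /avoids3 /bump; lia.
Qed.

Lemma active_ins_gt k i w : active (ins k w) (k + i).+1 = split_site w k i.
Proof.
rewrite /active /ins /= all3_map pairwise_map andbC; congr (_ && _).
  by apply: eq_all3 => x y z; rewrite /avoids3 /bump; lia.
by apply: eq_pairwise => y z; rewrite /= /avoids3 /avoids2 /bump; lia.
Qed.

Lemma split_site0 w k : split_site w k 0 = active w k.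
Proof.
rewrite /split_site addn0 [pairwise _ _](_ : _ = true) ?andbT //.
by apply/pairwise_subseqP => y z _; rewrite /avoids2; lia.
Qed.

(** As many values as positions: each letter occurs exactly once. *)
Definition perm_word (w : seq nat) := forall j, (j \in w) = (j < size w).

Lemma perm_word_ins k w : perm_word w -> k <= size w -> perm_word (ins k w).
Proof.
move=> pw le_kw j; rewrite inE /= size_map; apply/idP/idP.
  case/predU1P=> [-> // | /mapP[i]].
  by rewrite pw /bump => lt_iw ->; lia.
move=> lt_j; case: (ltngtP j k) => //= [lt_jk | lt_kj].
  by apply/mapP; exists j; rewrite ?pw /bump; lia.
by apply/mapP; exists j.-1; rewrite ?pw /bump; lia.
Qed.

Lemma subseq2_total (T : eqType) (s : seq T) x y :
  x \in s -> y \in s -> x != y -> subseq [:: x; y] s || subseq [:: y; x] s.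
Proof.
elim: s => // a s IHs; rewrite !inE /=.
have [-> | /= ne_xa] := eqVneq x a; have [-> | /= ne_ya] := eqVneq y a.
- by [].
- by rewrite !sub1seq => _ ->.
- by rewrite !sub1seq => ->; rewrite orbT.
exact: IHs.
Qed.

(** For [k = 0] the pairwise condition makes the letters below [i] decreasing and puts them before
    all others, which excludes every bad triple. *)
Lemma split_site_0l w i : split_site w 0 i = pairwise (avoids2 0 i) w.
Proof.
rewrite /split_site andb_idl // => /pairwise_subseqP w2.
apply/all3P => x y z xyz.
have /w2 xy : subseq [:: x; y] w.
  by apply: subseq_trans xyz; rewrite /= !eqxx.
have /w2 xz : subseq [:: x; z] w.
  by apply: subseq_trans xyz; rewrite /= eqxx; case: eqP => //= _; rewrite eqxx.
by move: xy xz; rewrite /avoids2 /avoids3; lia.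
Qed.

Lemma split_site_ins0 k i w : perm_word w -> k <= size w -> 0 < i <= (size w).+1 ->
  split_site (ins k w) 0 i = (k == i.-1) && ((i == 1) || split_site w 0 i.-1).
Proof.
move=> pw le_kw /andP[i_gt0 le_iw].
rewrite !split_site_0l /ins /= pairwise_map all_map.
have [-> | ne_ki] /= := eqVneq k i.-1; last first.
  apply/negP => /andP[/allP /= kw _].
  (* Too large a first letter is refuted by the later letter [0], too small a one by [i - 2], bumped
     to [i - 1]. *)
  have [le_ik | lt_ki] := leqP i k.
    by have /kw : 0 \in w; [rewrite pw; lia | rewrite /avoids2 /bump; lia].
  have /kw : i - 2 \in w by rewrite pw; lia.
  by rewrite /avoids2 /bump; lia.
have [/eqP -> /= | i_neq1] := boolP (i == 1).
  apply/andP; split; first by apply/allP => z _; rewrite /= /avoids2 /bump; lia.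
  by apply/pairwise_subseqP => y z _; rewrite /= /avoids2 /bump; lia.
rewrite [all _ _](_ : _ = true) /=.
  by apply: eq_pairwise => y z; rewrite /= /avoids2 /bump; lia.
by apply/allP => z _; rewrite /= /avoids2 /bump; lia.
Qed.

(** The first letter has to be [k - 1], the top of the first run. Removing it shortens that run by
    one and leaves the next run, of length [i], in place. *)
Lemma split_site_insS k0 k i w :
  perm_word w -> k0 <= size w -> 0 < i -> 0 < k -> k + i <= (size w).+1 ->
  split_site (ins k0 w) k i = (k0 == k.-1) && split_site w k0 i.
Proof.
move=> pw le_k0w i_gt0 k_gt0 le_kiw.
have [-> | ne_k0k] /= := eqVneq k0 k.-1.
  rewrite {1}/split_site [k + i](_ : _ = (k.-1 + i).+1); last by lia.
  rewrite active_ins_gt; apply: andb_idr => /andP[_ w2].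
  rewrite /ins /= pairwise_map all_map; apply/andP; split.
    by apply/allP => z _; rewrite /= /avoids2 /bump; lia.
  congr (is_true _): w2.
  by apply: eq_pairwise => y z; rewrite /= /avoids2 /bump; lia.
apply/negP => /andP[].
rewrite /active /ins /= all3_map !pairwise_map all_map => /andP[k0w3 _].
move=> /andP[/allP /= k0w2 w2].
have [le_kk0 | lt_k0k] := leqP k k0.
  have [le_kik0 | lt_k0ki] := leqP (k + i) k0.
    by have /k0w2 : k \in w; [rewrite pw; lia | rewrite /avoids2 /bump; lia].
  by have /k0w2 : 0 \in w; [rewrite pw; lia | rewrite /avoids2 /bump; lia].
(* The letters [k - 2] and [k - 1] are bumped to [k - 1] and [k]. In this order they complete 4123
   after the site [k + i] and [k0]; in the other order, 4231 after the sites [k + i] and [k]. *)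
have /orP[] : subseq [:: k - 2; k.-1] w || subseq [:: k.-1; k - 2] w.
- by apply: subseq2_total; rewrite ?pw; lia.
- by move/(pairwise_subseqP _ _ k0w3); rewrite /= /avoids3 /bump; lia.
- by move/(pairwise_subseqP _ _ w2); rewrite /= /avoids2 /bump; lia.
Qed.

(** * The generating tree *)

(* [sites] lists the active sites of a word [w] in increasing order; [run1] is
   the largest [a] such that [w] begins with [a-1 ... 1 0], and [run2] is the
   largest [b] such that [w] continues with [a+b-1 ... a] (with [b = 0] when
   [a = 0]). *)
Record state := State { sites : seq nat; run1 : nat; run2 : nat }.

Definition initial := State [:: 0] 0 0.

(** The letter [run1 st] extends the first run and keeps the second; otherwise [0] starts a new run
    and turns the old first run into the second; any other letter leaves no run. The [nseq] holds
    the only site beyond [k + 1] that can survive. *)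
Definition step st k :=
  let a := if k == run1 st then k.+1 else k == 0 in
  let b := if k == run1 st then run2 st else if k == 0 then run1 st else 0 in
  State ([seq j <- sites st | j <= k] ++ k.+1 :: nseq (0 < b) (a + b)) a b.

(** The default [1] of [head] rules out an empty list of sites. Once there is a first run, the two
    run lengths determine all sites. *)
Definition wf_state st :=
  [&& sorted ltn (sites st), head 1 (sites st) == 0 &
      if run1 st == 0 then run2 st == 0
      else sites st == iota 0 (run1 st).+1 ++ nseq (0 < run2 st) (run1 st + run2 st)].

(** The active sites alone do not determine those of a child: [split_site] tells which later ones
    survive, so it has to be part of the invariant. *)
Definition describes st w :=
  [/\ perm_word w, all (geq (size w)) (sites st),
      forall k, k <= size w -> active w k = (k \in sites st)
    & forall k i, 0 < i -> k + i <= size w ->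
        split_site w k i = (k == 0) && (i == run1 st)
                           || [&& 0 < k, k == run1 st & i == run2 st]].

Lemma wf_initial : wf_state initial. Proof. by []. Qed.

Lemma describes_initial : describes initial [::].
Proof.
split=> // [[] // | k i i_gt0].
by rewrite leqn0 addn_eq0 (gtn_eqF i_gt0) andbF.
Qed.

Lemma sites_le0 st : wf_state st -> [seq j <- sites st | j <= 0] = [:: 0].
Proof.
case/and3P; case: (sites st) => [|s0 s] //= sorted_s /eqP s0_eq0 _.
rewrite s0_eq0 /= in sorted_s *; congr (_ :: _).
rewrite -(filter_pred0 s); apply: eq_in_filter => j sj.
by have /allP/(_ j sj) := order_path_min ltn_trans sorted_s; case: j {sj}.
Qed.

Lemma sites_le_run1 st : wf_state st ->
  [seq j <- sites st | j <= run1 st] = iota 0 (run1 st).+1.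
Proof.
move=> wf_st; have [_ _] := and3P wf_st.
case: eqP => [-> _ | /eqP a_neq0 /eqP ->]; first exact: sites_le0.
rewrite filter_cat (_ : filter _ (nseq _ _) = [::]) ?cats0.
  by apply/all_filterP/allP => j; rewrite mem_iota; lia.
by case: (posnP (run2 st)) => //= b_gt0; rewrite ifF //; lia.
Qed.

Lemma run1_sites st : wf_state st -> run1 st \in sites st.
Proof.
move=> wf_st; have : run1 st \in [seq j <- sites st | j <= run1 st].
  by rewrite sites_le_run1 // mem_iota /= add0n ltnS.
by rewrite mem_filter => /andP[].
Qed.

Lemma wf_step st k : wf_state st -> wf_state (step st k).
Proof.
move=> wf_st; have [sorted_s s0 s_ab] := and3P wf_st.
apply/and3P; split.
- rewrite /= sorted_pairwise; last exact: ltn_trans.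
  rewrite pairwise_cat /=; apply/and3P; split.
  + apply/allrelP => i j; rewrite mem_filter inE mem_nseq => /andP[le_ik _].
    by have [?|?] := eqVneq k (run1 st); have [?|?] := eqVneq k 0 => /=; lia.
  + rewrite sorted_pairwise in sorted_s; last exact: ltn_trans.
    exact: pairwise_filter.
  + rewrite all_nseq; apply/andP; split; last by case: (0 < _).
    by have [?|?] := eqVneq k (run1 st); have [?|?] := eqVneq k 0 => /=; lia.
- by move: s0; rewrite /=; case: (sites st) => //= s1 s /eqP ->.
rewrite [run1 _]/= [sites _]/= [run2 _]/=.
have [-> | ne_ka] := eqVneq k (run1 st).
  rewrite sites_le_run1 // -[(run1 st).+2]addn1 iotaD -catA; exact: eqxx.
have [-> | _] := eqVneq k 0; last by [].
by rewrite /= sites_le0 // eqxx.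
Qed.

Lemma describes_step st w k : wf_state st -> describes st w -> k \in sites st ->
  describes (step st k) (ins k w).
Proof.
move=> wf_st [pw /allP le_sw act_w split_w] st_k.
have le_kw : k <= size w := le_sw k st_k.
have le_aw : run1 st <= size w by apply/le_sw/run1_sites.
have a0_b0 : run1 st = 0 -> run2 st = 0.
  by move=> a0; case/and3P: wf_st => _ _; rewrite a0 => /eqP.
have le_abw : 0 < run2 st -> run1 st + run2 st <= size w.
  move=> b_gt0; apply: le_sw; case/and3P: wf_st => _ _.
  case: eqP => [/a0_b0 | _ /eqP ->]; first by lia.
  by rewrite mem_cat b_gt0 mem_seq1 eqxx orbT.
split.
- exact: perm_word_ins.
- apply/allP => j; rewrite /= size_map mem_cat inE mem_nseq mem_filter.
  have [/= ->| ne_ka] := eqVneq k (run1 st); have [/=|/=] := eqVneq k 0; lia.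
- move=> j; rewrite /= size_map mem_cat inE mem_nseq mem_filter => le_jw.
  have [le_jk | lt_kj] := leqP j k.
    rewrite active_ins_le // act_w; last by lia.
    have [?|?] := eqVneq k (run1 st); have [?|?] := eqVneq k 0 => /=; lia.
  have -> : j = (k + (j - k.+1)).+1 by lia.
  rewrite active_ins_gt; have [-> | j_gt] := posnP (j - k.+1).
    by rewrite split_site0 act_w // st_k addn0 eqxx orbT.
  rewrite split_w; try lia.
  have [?|?] := eqVneq k (run1 st); have [?|?] := eqVneq k 0 => /=; lia.
move=> j i i_gt0; rewrite /= size_map => le_ji.
have [-> | j_gt0] := posnP j.
  rewrite split_site_ins0 //; last by lia.
  have [-> | i_neq1] := eqVneq i 1.
    by have [?|?] := eqVneq k (run1 st); have [?|?] := eqVneq k 0 => /=; lia.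
  rewrite split_w; try lia.
  by have [?|?] := eqVneq k (run1 st); have [?|?] := eqVneq k 0 => /=; lia.
rewrite split_site_insS //; have [k_j | k_neq_j] := eqVneq k j.-1.
  rewrite split_w; try lia.
  by have [?|?] := eqVneq k (run1 st); have [?|?] := eqVneq k 0 => /=; lia.
by have [?|?] := eqVneq k (run1 st); have [?|?] := eqVneq k 0 => /=; lia.
Qed.

(** * From permutations to words *)

Fixpoint descendants n w : nat :=
  if n is m.+1 then \sum_(k < (size w).+1 | active w k) descendants m (ins k w)
  else 1.

(* The letter [j] of [word p] is the number of entries of [p] to the right of the
   value [j], so that a new first letter [k] is a new minimum of [p] followed by
   [k] entries. *)
Definition word n (p : 'S_n) : seq nat :=
  [seq val (rev_ord (p^-1%g i)) | i <- enum 'I_n].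

(** The value [0] goes to position [n - ks.1], so that exactly [ks.1] entries follow it. *)
Definition insert_min n (ks : 'I_n.+1 * 'S_n) : 'S_n.+1 :=
  lift_perm (rev_ord ks.1) ord0 ks.2.

Lemma word_insert_min n ks : word (@insert_min n ks) = ins ks.1 (word ks.2).
Proof.
case: ks => k s; rewrite /word /insert_min enum_ordSl lift_permV map_cons.
rewrite lift_perm_id rev_ordK /ins -!map_comp; congr (_ :: _).
apply: eq_map => i.
rewrite /= lift_perm_lift /= /bump.
have := ltn_ord k; have := ltn_ord (s^-1%g i).
move: (val _) (val k) => /= a b; lia.
Qed.

Lemma insert_min_bij n : bijective (@insert_min n).
Proof.
apply: inj_card_bij; last by rewrite card_prod !card_Sn card_ord factS.
move=> [k s] [k' s']; rewrite /insert_min /= => eq_ks.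
have eq_k : k = k'.
  apply: rev_ord_inj; apply: (@perm_inj _ (lift_perm (rev_ord k) ord0 s)).
  by rewrite {2}eq_ks !lift_perm_id.
rewrite -eq_k in eq_ks *; congr (_, _); apply/permP => i.
by apply: (@lift_inj _ ord0); rewrite -!(lift_perm_lift (rev_ord k)) eq_ks.
Qed.

Lemma size_word n (p : 'S_n) : size (word p) = n.
Proof. by rewrite size_map size_enum_ord. Qed.

(** An avoider of size [n + 1] arises from exactly one avoider of size [n], by one insertion at an
    active site. *)
Lemma sum_descendantsS n m :
  (\sum_(p : 'S_n.+1 | avoiding (word p)) descendants m (word p) =
   \sum_(p : 'S_n | avoiding (word p)) descendants m.+1 (word p))%N.
Proof.
have [g gK Kg] := @insert_min_bij n.
rewrite (reindex (@insert_min n)) /=; last first.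
  by exists g => ? _; [apply: gK | apply: Kg].
rewrite (eq_bigr (fun ks : 'I_n.+1 * 'S_n =>
           descendants m (ins ks.1 (word ks.2)))) => [|ks _]; last first.
  by rewrite word_insert_min.
rewrite (eq_bigl (fun ks : 'I_n.+1 * 'S_n =>
           active (word ks.2) ks.1 && avoiding (word ks.2))) => [|ks]; last first.
  by rewrite word_insert_min avoiding_ins.
under [RHS]eq_bigr do rewrite size_word.
rewrite [RHS](exchange_big_dep predT) //= pair_big_dep /=.
by apply: eq_bigl => ks; rewrite andbC.
Qed.

Lemma card_avoiding n : #|[set p : 'S_n | avoiding (word p)]| = descendants n [::].
Proof.
rewrite -sum1dep_card.
(* Counting [m] further levels lets the induction on [k] trade size for depth; [m = 0] gives the
   count. *)
suff sum_eq k m : \sum_(p : 'S_k | avoiding (word p)) descendants m (word p)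
                  = descendants (k + m) [::].
  by rewrite -[n in RHS]addn0 -sum_eq; apply: eq_bigr.
elim: k m => [|k IHk] m; last by rewrite sum_descendantsS IHk addSnnS.
have word0 (p : 'S_0) : word p = [::] by apply/size0nil; rewrite size_word.
rewrite (eq_bigr (fun _ => descendants m [::])) => [|p _]; last by rewrite word0.
rewrite (eq_bigl predT) => [|p]; last by rewrite word0.
by rewrite sum_nat_const card_Sn mul1n.
Qed.

(** * Pattern containment read on words *)

Lemma subseq_enum_ord n (t : seq 'I_n) :
  subseq t (enum 'I_n) = sorted ltn (map val t).
Proof.
have inc_enum : sorted ltn (map val (enum 'I_n)).
  by rewrite val_enum_ord iota_ltn_sorted.
have tr : transitive (relpre (val : 'I_n -> nat) ltn) by move=> j i k; apply: ltn_trans.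
rewrite sorted_map in inc_enum; rewrite sorted_map; apply/idP/idP => [sub_t | inc_t].
  exact: (subseq_sorted tr sub_t inc_enum).
have -> : t = [seq i <- enum 'I_n | i \in t]; last exact: filter_subseq.
apply: (irr_sorted_eq tr) => // [i||i]; first exact: ltnn.
  exact: sorted_filter.
by rewrite mem_filter mem_enum andbT.
Qed.

Lemma order_iso4 a b c d a' b' c' d' :
  order_iso [:: a; b; c; d] [:: a'; b'; c'; d'] =
  all (fun r => all (fun s => (r.1 < s.1) == (r.2 < s.2))
         [:: (a, a'); (b, b'); (c, c'); (d, d')])
      [:: (a, a'); (b, b'); (c, c'); (d, d')].
Proof.
have E (P : pred 'I_4) : [forall i, P i] =
    [&& P ord0, P (lift ord0 ord0), P (lift ord0 (lift ord0 ord0)) & P ord_max].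
  apply/forallP/and4P => [// | [P0 P1 P2 P3] [[|[|[|[|//]]]] lt_i4]].
  - by rewrite (_ : Ordinal _ = ord0) //; apply: val_inj.
  - by rewrite (_ : Ordinal _ = lift ord0 ord0) //; apply: val_inj.
  - by rewrite (_ : Ordinal _ = lift ord0 (lift ord0 ord0)) //; apply: val_inj.
  - by rewrite (_ : Ordinal _ = ord_max) //; apply: val_inj.
by rewrite /order_iso /= !E /= !andbT.
Qed.

Lemma contains4P n (p : 'S_n) a b c d :
  reflect (exists i j k l : 'I_n, [&& i < j, j < k & k < l] /\
             order_iso [:: p i : nat; p j : nat; p k : nat; p l : nat] [:: a; b; c; d])
          (contains p [:: a; b; c; d]).
Proof.
have succ4 x y z t : order_iso [:: x.+1; y.+1; z.+1; t.+1] [:: a; b; c; d] =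
                     order_iso [:: x; y; z; t] [:: a; b; c; d].
  by rewrite !order_iso4.
apply: (iffP (containsP p _)) => [[s /subseqP[m sz_m ->]] | [i [j [k [l [lt_ijkl iso]]]]]].
  rewrite /oneline -map_mask; set t := mask m _ => iso.
  have : subseq t (enum 'I_n) by apply: mask_subseq.
  have /eqP : size [seq (p i).+1 | i <- t] == 4 by case/andP: iso.
  rewrite size_map subseq_enum_ord; case: t iso => [|i [|j [|k [|l []]]]] //= iso _ lt_t.
  by exists i, j, k, l; rewrite -succ4; split; rewrite // -[_ < l]andbT.
exists [seq (p i).+1 | i <- [:: i; j; k; l]]; last by rewrite /= succ4.
by apply: map_subseq; rewrite subseq_enum_ord /= andbT.
Qed.

Lemma avoiders_word n :
  avoiders n [:: [:: 1; 3; 2; 4]; [:: 1; 4; 3; 2]; [:: 3; 1; 4; 2]] =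
  [set p : 'S_n | avoiding (word p)].
Proof.
apply/setP => p; rewrite !inE /= andbT; apply/and3P/idP => [[no1 no2 no3] | ].
  rewrite /avoiding /word all4_map; apply/all4P => a b c d.
  rewrite subseq_enum_ord /= andbT => lt_abcd; apply/negP => bad.
  have lt_an := ltn_ord (p^-1 a)%g; have lt_bn := ltn_ord (p^-1 b)%g.
  have lt_cn := ltn_ord (p^-1 c)%g; have lt_dn := ltn_ord (p^-1 d)%g.
  (* Letters are reversed positions, so listing the values by decreasing letter gives their
     left-to-right order in [p]. *)
  case/or3P: bad => bad.
  - case/negP: no1; apply/contains4P.
    exists (p^-1 a)%g, (p^-1 c)%g, (p^-1 b)%g, (p^-1 d)%g.
    by rewrite order_iso4 !permKV /=; lia.
  - case/negP: no2; apply/contains4P.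
    exists (p^-1 a)%g, (p^-1 d)%g, (p^-1 c)%g, (p^-1 b)%g.
    by rewrite order_iso4 !permKV /=; lia.
  - case/negP: no3; apply/contains4P.
    exists (p^-1 c)%g, (p^-1 a)%g, (p^-1 d)%g, (p^-1 b)%g.
    by rewrite order_iso4 !permKV /=; lia.
rewrite /avoiding /word all4_map => /all4P av.
have {}av (a b c d : 'I_n) := av (p a) (p b) (p c) (p d).
split; apply/negP => /contains4P[i [j [k [l [lt_ijkl]]]]];
  rewrite order_iso4 /= => iso;
  have := ltn_ord i; have := ltn_ord j; have := ltn_ord k; have := ltn_ord l.
(* Conversely, the four positions are listed by increasing entry, the order in which [word p] reads
   them. *)
- have := av i k j l; rewrite subseq_enum_ord !permK /avoids4 /=; lia.
- have := av i l k j; rewrite subseq_enum_ord !permK /avoids4 /=; lia.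
- have := av j l i k; rewrite subseq_enum_ord !permK /avoids4 /=; lia.
Qed.

(** * Generating functions *)

Local Open Scope ring_scope.

(** * Coefficients of power series and the Euler derivation *)

Section Series.
Variable K : fieldType.
Implicit Types f g : {fps K}.
Local Notation x := (fpsX K).

Lemma coef_fpsD f g n : (f + g) n = f n + g n. Proof. by []. Qed.

Lemma coef_fpsB f g n : (f - g) n = f n - g n. Proof. by []. Qed.

Lemma coef_fps1 n : (1 : {fps K}) n = (n == 0%N)%:R. Proof. by []. Qed.

Lemma coef_fps0M f g : (f * g) 0%N = f 0%N * g 0%N.
Proof. by rewrite [LHS]big_ord_recl big_ord0 addr0. Qed.

Lemma coef_fpsXM f n : (x * f) n = if n is m.+1 then f m else 0.
Proof.
case: n => [|n]; first by rewrite coef_fps0M /= mul0r.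
rewrite [LHS]big_ord_recl /= mul0r add0r big_ord_recl /= mul1r subSS subn0.
by rewrite big1 ?addr0 // => i _; rewrite mul0r.
Qed.

Lemma coef_fps_sum (I : Type) (r : seq I) (f : I -> {fps K}) n :
  (\sum_(i <- r) f i) n = \sum_(i <- r) f i n.
Proof. by elim: r => [|i r IHr]; rewrite ?big_nil // !big_cons -IHr. Qed.

(** This is the operator [x d/dx]; it turns recurrences with factors linear in [n] into differential
    equations. *)
Definition fps_theta f : {fps K} := \fps_n (n%:R * f n).

Lemma coef_theta f n : fps_theta f n = n%:R * f n. Proof. by []. Qed.

Lemma fps_thetaD f g : fps_theta (f + g) = fps_theta f + fps_theta g.
Proof. by apply: fpsP => n /=; rewrite mulrDr. Qed.

Lemma fps_thetaB f g : fps_theta (f - g) = fps_theta f - fps_theta g.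
Proof. by apply: fpsP => n /=; rewrite mulrBr. Qed.

Lemma fps_theta1 : fps_theta 1 = 0.
Proof. by apply: fpsP => -[|n] /=; rewrite ?mul0r ?mulr0. Qed.

Lemma fps_thetaX : fps_theta x = x.
Proof. by apply: fpsP => -[|[|n]] /=; rewrite ?mul0r ?mulr1 ?mulr0. Qed.

Lemma fps_thetaM f g : fps_theta (f * g) = fps_theta f * g + f * fps_theta g.
Proof.
apply: fpsP => n /=; rewrite mulr_sumr -big_split; apply: eq_bigr => i _ /=.
have -> : n%:R = i%:R + (n - i)%:R :> K by rewrite -natrD subnKC ?leq_ord.
by ring.
Qed.

End Series.

(** * The quadratic equation of the Catalan series *)

Section Catalan.
Local Notation x := (fpsX rat).
Local Notation C := catalan_gf.

Lemma catalan_rec n : n.+2%:R * C n.+1 = (4 * n + 2)%:R * C n :> rat.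
Proof.
have bin_rec : (n.+1 * 'C(2 * n.+1, n.+1) = (4 * n + 2) * 'C(2 * n, n))%N.
  have down := mul_bin_down (2 * n).+1 n.
  rewrite /= (_ : (2 * n).+1 - n = n.+1)%N in down; last by lia.
  rewrite -mul_bin_diag [(2 * n.+1).-1](_ : _ = (2 * n).+1)%N; last by lia.
  by rewrite -mulnA -down mulnA; congr (_ * _)%N; lia.
have nz k : k.+1%:R != 0 :> rat by rewrite pnatr_eq0.
by rewrite /= mulrC divfK // mulrA -natrM -bin_rec natrM mulrAC mulfV // mul1r.
Qed.

Lemma catalan_ode : (1 - 4 * x) * fps_theta C + (1 - 2 * x) * C = 1.
Proof.
have -> : (1 - 4 * x) * fps_theta C + (1 - 2 * x) * C =
    fps_theta C + C - x * (fps_theta C *+ 4 + C *+ 2) by ring.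
apply: fpsP => -[|n]; rewrite coef_fpsB coef_fpsXM !coef_fpsD.
  by rewrite subr0 /= mul0r add0r bin0 divr1.
rewrite !coef_theta -{2}[C n.+1]mul1r -mulrDl -mulrSr catalan_rec natrD natrM.
by rewrite coef_fps1 eqn0Ngt /=; move: (C n) (n%:R) => c m; ring.
Qed.

(** The defect [y] of the equation satisfies a homogeneous differential equation that determines
    each coefficient from the previous one, starting from zero. *)
Lemma catalan_eq : C = 1 + x * C ^+ 2.
Proof.
pose y := x * C ^+ 2 - C + 1.
have y_ode : fps_theta y + y = x * (fps_theta y *+ 4).
  have -> : fps_theta y = x * C ^+ 2 + 2 * x * C * fps_theta C - fps_theta C.
    by rewrite fps_thetaD fps_thetaB fps_theta1 expr2 !fps_thetaM fps_thetaX; ring.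
  apply/eqP; rewrite -subr_eq0; apply/eqP.
  (* The factor [2 x C - 1] is the derivative of [x C^2 - C + 1] with respect to [C]. *)
  transitivity ((2 * x * C - 1) *
                ((1 - 4 * x) * fps_theta C + (1 - 2 * x) * C - 1)).
    by rewrite /y; ring.
  by rewrite catalan_ode subrr mulr0.
have y_coef n : n.+1%:R * y n = (x * (fps_theta y *+ 4)) n.
  by rewrite -y_ode /= mulrSr mulrDl mul1r.
suff y0 n : y n = 0.
  have {y_ode y_coef}/eqP : y = 0 by apply: fpsP => n; rewrite y0.
  by rewrite /y addrAC subr_eq0 addrC => /eqP.
have nz k : k.+1%:R != 0 :> rat by rewrite pnatr_eq0.
apply: (mulfI (nz n)); rewrite mulr0 y_coef.
elim: n => [|n IHn]; rewrite coef_fpsXM // !coef_fpsD coef_theta.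
by rewrite (_ : y n = 0) ?mulr0 ?addr0 //; apply: (mulfI (nz n)); rewrite mulr0 y_coef.
Qed.

End Catalan.

Lemma count_geq_iota k n : count (geq k) (iota 0 n) = minn k.+1 n.
Proof.
elim: n => [|n IHn]; first by rewrite minn0.
by rewrite -addn1 iotaD count_cat IHn /=; lia.
Qed.

(** In a strictly increasing list, [count (geq k) s] is the rank of [k]. *)
Lemma sum_count_geq (V : nmodType) (h : nat -> V) s : sorted ltn s ->
  \sum_(k <- s) h (count (geq k) s) = \sum_(k <- iota 1 (size s)) h k.
Proof.
elim/last_ind: s => [|s z IHs]; first by rewrite !big_nil.
rewrite (sorted_pairwise ltn_trans) -cats1 pairwise_cat allrel1r.
case/and3P=> /allP lt_sz; rewrite -(sorted_pairwise ltn_trans) => s_inc _.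
rewrite size_cat iotaD !big_cat !big_seq1 -IHs //.
congr (_ + h _).
  apply: eq_big_seq => k sk; rewrite count_cat /=.
  by rewrite leqNgt (lt_sz k sk) !addn0.
rewrite count_cat /= leqnn addnC; congr (_ + _)%N.
by apply/eqP; rewrite -all_count; apply/allP => k /lt_sz /ltnW.
Qed.

(** * Solving the functional equations of the tree *)

Section TreeSeries.
Local Notation x := (fpsX rat).
Local Notation C := catalan_gf.

(** The sum telescopes, since the Catalan equation gives [x C^(k+2) = C^(k+1) - C^k]. *)
Lemma sum_catalan_pow n : x * (\sum_(k <- iota 1 n) C ^+ k.+1) = C ^+ n - 1.
Proof.
elim: n => [|n IHn]; first by rewrite big_nil mulr0 subrr.
rewrite -[n.+1]addn1 iotaD big_cat big_seq1 mulrDr IHn add1n addn1.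
apply/eqP; rewrite -subr_eq0; apply/eqP.
transitivity (C ^+ n * (1 + x * C ^+ 2 - C)); first by rewrite !exprS; ring.
by rewrite -catalan_eq subrr mulr0.
Qed.

Variables F B : {fps rat}.
(** [F_eq] is the equation of the root, whose only child has a first run of length one and series
    [B + F C]. [B_eq] is what the equation of a node with a first run becomes once the powers of [C]
    depending on its length cancel. *)
Hypothesis F_eq : F = 1 + x * B + x * F * C.
Hypothesis B_eq : B = 1 + x * (B + F * (1 + x * C ^+ 3) * C) - F + x * B.

(* Generating function of the descendants of a node, found by solving the
   functional equations of the generating tree: the sequence [C ^+ s] solves
   [n_s = n_{s-1} + x n_{s+1}]. *)
Definition tree_gf st : {fps rat} :=
  if run1 st == 0%N then F * C ^+ (size (sites st)).-1
  else B + F * (if run2 st == 0%N then 1 else 1 + x * C ^+ 3) * C ^+ run1 st.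

Lemma tree_gf_step0 st k : k != run1 st -> k != 0%N ->
  tree_gf (step st k) = F * C ^+ count (geq k) (sites st).
Proof.
move=> ne_k ne_k0; rewrite /tree_gf /step /= (negbTE ne_k) (negbTE ne_k0) /=.
by rewrite size_cat addn1 size_filter.
Qed.

Lemma tree_gf_eq st : wf_state st ->
  tree_gf st = 1 + x * \sum_(k <- sites st) tree_gf (step st k).
Proof.
move=> wf_st; have [sorted_s s0 s_ab] := and3P wf_st.
have C0 : C - 1 - x * C ^+ 2 = 0 by rewrite {1}catalan_eq; ring.
have F0 : F - (1 + x * B + x * F * C) = 0 by rewrite -F_eq subrr.
have B0 : B - (1 + x * (B + F * (1 + x * C ^+ 3) * C) - F + x * B) = 0.
  by rewrite -B_eq subrr.
move: s_ab; case: eqP => [a0 /eqP b0 | /eqP a_neq0 /eqP st_eq].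
  case s_eq: (sites st) s0 sorted_s => [|z s] //= /eqP z0; rewrite z0 /= in s_eq * => s_path.
  have s_sorted : sorted ltn s by apply: path_sorted s_path.
  have s_gt0 k : k \in s -> k != 0%N.
    by move=> sk; rewrite -lt0n; apply: (allP (order_path_min ltn_trans s_path)).
  (* Without a run, site [0] yields the child [B + F C], and the other children depend only on the
     rank of their site. *)
  rewrite big_cons (eq_big_seq (fun k => F * C ^+ (count (geq k) s).+1)).
    rewrite -mulr_sumr (sum_count_geq (fun k => C ^+ k.+1)) //.
    rewrite /tree_gf a0 /= s_eq b0 a0 /= expr1.
    have := sum_catalan_pow (size s); set S := \sum_(k <- _) _ => S_eq.
    apply/eqP; rewrite -subr_eq0; apply/eqP.
    transitivity (F - (1 + x * B + x * F * C) - F * (x * S - (C ^+ size s - 1))).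
      by ring.
    by rewrite F0 S_eq subrr mulr0 subrr.
  by move=> k /s_gt0 k_neq0; rewrite tree_gf_step0 ?a0 // s_eq /= add1n.
case a_eq: (run1 st) a_neq0 st_eq => [//|a] _ st_eq.
rewrite st_eq (_ : iota 0 a.+2 = 0%N :: iota 1 a ++ [:: a.+1]); last first.
  by congr (_ :: _); rewrite -(iotaD 1 a 1) addn1.
rewrite big_cat big_cons big_cat big_seq1.
rewrite (eq_big_seq (fun k => F * C ^+ k.+1)); last first.
  move=> k; rewrite mem_iota => k_a; rewrite tree_gf_step0 ?a_eq; try lia.
  rewrite st_eq count_cat count_geq_iota count_nseq /=; congr (_ * _ ^+ _); lia.
rewrite -mulr_sumr.
have := sum_catalan_pow a; set S := \sum_(k <- iota 1 a) _ => S_eq.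
have gf_step0 : tree_gf (step st 0) = B + F * (1 + x * C ^+ 3) * C.
  by rewrite /tree_gf /= a_eq.
have gf_stepS e : e = (if run2 st == 0%N then 1 else 1 + x * C ^+ 3) ->
    tree_gf (step st a.+1) = B + F * e * C ^+ a.+2.
  by move=> ->; rewrite /tree_gf /= a_eq eqxx.
have gf_st e : e = (if run2 st == 0%N then 1 else 1 + x * C ^+ 3) ->
    tree_gf st = B + F * e * C ^+ a.+1.
  by move=> ->; rewrite /tree_gf a_eq.
rewrite gf_step0; apply/eqP; rewrite -subr_eq0; apply/eqP.
have [b0 | b_gt0] := posnP (run2 st).
  rewrite (gf_st 1) ?b0 // (gf_stepS 1) ?b0 // big_nil.
  transitivity ((B - (1 + x * (B + F * (1 + x * C ^+ 3) * C) - F + x * B))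
    + F * C ^+ a * (C - 1 - x * C ^+ 2) - F * (x * S - (C ^+ a - 1))).
    by rewrite /= !exprS; ring.
  by rewrite C0 B0 S_eq !subrr !mulr0 !subr0 ?addr0.
have b_neq0 : run2 st == 0%N = false by rewrite gtn_eqF.
rewrite (gf_st (1 + x * C ^+ 3)) ?b_neq0 // (gf_stepS (1 + x * C ^+ 3)) ?b_neq0 //.
(* The extra site has rank [a + 3]; its term [x F C^(a+3)] accounts for the factor [1 + x C^3]. *)
rewrite big_seq1 tree_gf_step0 ?a_eq; try lia.
rewrite st_eq count_cat count_geq_iota count_nseq b_gt0 [(_ + _)%N](_ : _ = a.+3); last first.
  by rewrite /=; lia.
transitivity ((B - (1 + x * (B + F * (1 + x * C ^+ 3) * C) - F + x * B))
  + F * (1 + x * C ^+ 3) * C ^+ a * (C - 1 - x * C ^+ 2)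
  - F * (x * S - (C ^+ a - 1))).
  by rewrite /= !exprS; ring.
by rewrite C0 B0 S_eq !subrr !mulr0 !subr0 ?addr0.
Qed.

End TreeSeries.

Lemma descendants_tree_gf (F B : {fps rat}) :
    let x := fpsX rat in let C := catalan_gf in
    F = 1 + x * B + x * F * C ->
    B = 1 + x * (B + F * (1 + x * C ^+ 3) * C) - F + x * B ->
  forall n st w, wf_state st -> describes st w ->
  (descendants n w)%:R = tree_gf F B st n.
Proof.
move=> x C F_eq B_eq n; elim: n => [|n IHn] st w wf_st st_w;
  rewrite (tree_gf_eq F_eq B_eq wf_st) coef_fpsD coef_fps1 coef_fpsXM.
  by rewrite addr0.
have [pw /allP le_sw act_w _] := st_w.
rewrite add0r coef_fps_sum /= -(big_mkord (active w) (fun k => descendants n (ins k w))).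
(* The sum over active insertions becomes the sum over [sites st] of [tree_gf_eq]. *)
rewrite natr_sum -big_filter (perm_big (sites st)).
  apply: eq_big_seq => k st_k; rewrite (IHn (step st k)) //; first exact: wf_step.
  exact: describes_step.
apply: uniq_perm => [||k]; first by rewrite filter_uniq ?iota_uniq.
  by have /and3P[/(sorted_uniq ltn_trans ltnn)] := wf_st.
rewrite mem_filter mem_iota subn0 add0n ltnS leq0n /=.
case: leqP => [/act_w -> | lt_wk]; first by rewrite andbT.
by rewrite andbF; apply/esym/negP => /le_sw; rewrite /= leqNgt lt_wk.
Qed.

Theorem theorem32 :
  let x : {fps rat} := fpsX rat in
  let C := catalan_gf in
  avoid_gf [:: [:: 1; 3; 2; 4]; [:: 1; 4; 3; 2]; [:: 3; 1; 4; 2]]%N =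
    (1 - x) / (2 - 2 * x - (1 - x - x ^+ 2) * C).
Proof.
move=> x C; set D := 2 - _ - _; set F := _ / D.
have C_eq : 1 + x * C ^+ 2 - C = 0 by rewrite -catalan_eq subrr.
have D_unit : D \is a GRing.unit.
  rewrite unit_fpsE /D 2!coef_fpsB !coef_fps0M !coef_fpsB /=.
  by rewrite big_ord1 bin0 divr1 !mulr0 !subr0.
have E_unit : 1 - 2 * x \is a GRing.unit.
  by rewrite unit_fpsE coef_fpsB coef_fps0M [x _]/= mulr0 subr0 oner_eq0.
have FD : F * D = 1 - x by rewrite /F divrK.
(* [B] is obtained by solving [B_eq], which is linear in [B]. *)
pose B := (1 - F + x * F * C + x ^+ 2 * F * C ^+ 4) / (1 - 2 * x).
have BE : B * (1 - 2 * x) = 1 - F + x * F * C + x ^+ 2 * F * C ^+ 4.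
  by rewrite /B divrK.
have B_eq : B = 1 + x * (B + F * (1 + x * C ^+ 3) * C) - F + x * B.
  apply/eqP; rewrite -subr_eq0; apply/eqP.
  transitivity (B * (1 - 2 * x) - (1 - F + x * F * C + x ^+ 2 * F * C ^+ 4)).
    by ring.
  by rewrite BE subrr.
have F_eq : F = 1 + x * B + x * F * C.
  apply: (mulIr E_unit); apply/eqP; rewrite -subr_eq0; apply/eqP.
  (* Multiplied by [1 - 2 x], the equation is a combination of the definitions of [F] and [B] and of
     the Catalan equation. *)
  transitivity (F * D - (1 - x)
    - x * (B * (1 - 2 * x) - (1 - F + x * F * C + x ^+ 2 * F * C ^+ 4))
    - F * (1 + x * (x * C ^+ 2 + C - 1)) * (1 + x * C ^+ 2 - C)).
    by rewrite /D; ring.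
  by rewrite FD BE C_eq !subrr !mulr0 !subr0.
apply: fpsP => n; rewrite [LHS]/= avoiders_word card_avoiding.
rewrite (descendants_tree_gf F_eq B_eq n wf_initial describes_initial).
by rewrite /tree_gf mulr1.
Qed.
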